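(* Let $X$ be a finite set which is closed under formal inversion, $X=X^{-1}$, and let $G=\langle X\rangle$. Let $L\subseteq X^*$ be a regular language, and let $P=\pi(L)$, where $\pi:X^*\to G$ is the evaluation map onto $G$. Let $H$ be a subgroup of $G$. If $H$ is language-convex with respect to $L$, then there exists a regular language $L_H\subseteq X^*$ such that $\pi(L_H)=H\cap P$.
   Context: $X^*$ is the free monoid of words over the finite set $X$; a language over $X$ is a subset of $X^*$, and it is regular if it is accepted by a finite state automaton. The evaluation map $\pi:X^*\to G$ is the monoid homomorphism sending each word to the element of $G$ it represents. Let $\Gamma$ be the Cayley graph of $G$ with respect to $X$, with its graph metric. A word $w=x_1\dots x_n\in X^*$ (with each $x_i\in X$) induces the path $p_w$ in $\Gamma$ starting at $1$ and passing successively through the vertices $\pi(x_1\dots x_i)$, $0\le i\le n$. A subset $H\subseteq G$ is language-convex with respect to a language $L$ over $X$ if there exists $R\ge 0$ such that for each $w\in L$ with $\pi(w)\in H$, the induced path $p_w$ lies within distance $R$ of $H$ in $\Gamma$. *)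

(* Defs.v *)
From HB Require Import structures.
From mathcomp Require Import all_boot.
From mathcomp Require Import boolp classical_sets.

Set Implicit Arguments.
Unset Strict Implicit.
Unset Printing Implicit Defensive.

Local Open Scope classical_set_scope.
Local Open Scope group_scope.

Record dfa (X : finType) := Dfa {
  dfa_state : finType;
  dfa_init : dfa_state;
  dfa_final : {set dfa_state};
  dfa_trans : dfa_state -> X -> dfa_state }.

Definition dfa_accepts (X : finType) (A : dfa X) (w : seq X) : bool :=
  foldl (@dfa_trans X A) (dfa_init A) w \in dfa_final A.

Definition regular (X : finType) (L : set (seq X)) : Prop :=
  exists A : dfa X, L = [set w | dfa_accepts A w].

Definition subgroup (G : groupType) (H : set G) : Prop :=
  group_closed (mem H).

(* The letters of X are symbols, with gen_inv their formal inversion; gen_val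
   need not be injective. When X is a subset of G, gen_val is the inclusion. *)
Record genset (X : finType) (G : groupType) := Genset {
  gen_val :> X -> G;
  gen_inv : X -> X;
  gen_invK : involutive gen_inv;
  gen_valV : forall x, gen_val (gen_inv x) = (gen_val x)^-1;
  gen_span : forall K : set G, subgroup K -> range gen_val `<=` K -> K = setT }.

Section Cayley.
Variables (X : finType) (G : groupType) (S : genset X G).

Definition eval (w : seq X) : G := \prod_(x <- w) S x.

Definition cayley : rel G := fun g h => [exists x, h == g * S x].

Definition cayley_walk (n : nat) (g h : G) : Prop :=
  exists p : seq G, [/\ path cayley g p, last g p = h & size p = n].

Lemma cayley_walkP n g h :
  cayley_walk n g h <-> exists2 w, size w = n & g * eval w = h.
Proof.
split=> [[p []]|[w]].
  elim: p g n => [|g1 p IHp] g n /=.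
    by move=> _ <- <-; exists [::]; rewrite // /eval big_nil mulg1.
  case/andP=> /existsP[x /eqP ->] /IHp{}IHp /IHp{}IHp <-.
  have [w sw <-] := IHp _ erefl; exists (x :: w); first by rewrite /= sw.
  by rewrite /eval big_cons mulgA.
elim: w g n => [|x w IHw] g n /= <-.
  by rewrite /eval big_nil mulg1 => <-; exists [::].
rewrite /eval big_cons mulgA => /(IHw _ _ erefl)[p [gp lp sp]].
exists (g * S x :: p); split=> //=; last by rewrite sp.
by rewrite gp andbT; apply/existsP; exists x.
Qed.

Lemma eval_cat u v : eval (u ++ v) = eval u * eval v.
Proof. exact: big_cat. Qed.

Lemma eval_inv u : eval (rev (map (gen_inv S) u)) = (eval u)^-1.
Proof.
elim: u => [|x u IHu]; first by rewrite /eval big_nil invg1.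
rewrite /= rev_cons -cats1 eval_cat IHu /eval !big_cons big_nil gen_valV mulg1.
by rewrite invgM.
Qed.

Lemma eval_surj g : exists w, eval w = g.
Proof.
suff: range eval = setT by move=> /seteqP[_ /(_ g I)[w _ <-]]; exists w.
apply: (gen_span (g := S)); last first.
  by move=> _ [x _ <-]; exists [:: x]; rewrite // /eval big_cons big_nil mulg1.
split; first by rewrite inE; exists [::]; rewrite // /eval big_nil.
move=> _ _ /set_mem[u _ <-] /set_mem[v _ <-]; apply/mem_set.
by exists (u ++ rev (map (gen_inv S) v)); rewrite // eval_cat eval_inv.
Qed.

Lemma cayley_connected g h : exists n, `[< cayley_walk n g h >].
Proof.
have [w ew] := eval_surj (g^-1 * h).
exists (size w); apply/asboolP/cayley_walkP; exists w => //.
by rewrite ew mulgA mulgV mul1g.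
Qed.

Definition cayley_dist (g h : G) : nat := ex_minn (cayley_connected g h).

Definition induced_path (w : seq X) : seq G :=
  [seq eval (take i w) | i <- iota 0 (size w).+1].

(* Only the vertices of the path and natural R are considered: vertex distances
   are integers and points on edges are within 1/2 of a vertex, so the existence
   of some R is unaffected. *)
Definition language_convex (L : set (seq X)) (H : set G) : Prop :=
  exists R : nat, forall w, L w -> H (eval w) ->
    forall v, v \in induced_path w -> exists2 h, H h & cayley_dist v h <= R.

End Cayley.

(* Main.v *)
Require Import Defs.
From mathcomp Require Import all_boot.
From mathcomp Require Import boolp classical_sets.

Local Open Scope classical_set_scope.

(** The language L_H consists of the words of L that evaluate into H, so that
    its image is H `&` P by construction; convexity is what makes it regular.
    In a word w of L with value in H, every prefix value v lies within distance
    R of H, that is, v * eval u belongs to H for some word u of length at most R.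
    The right coset H v is the inverse of the left coset (eval u) H, so only
    finitely many right cosets occur along w, each of them recorded by such a
    word u. Reading a letter x moves H v to H v x, which depends on H v and x
    only. Hence a finite automaton can follow the coset of the prefix read so
    far, sinking as soon as no short word records it, and decide at the end
    whether that coset is H. Its product with an automaton for L recognizes L_H:
    [coset_run_sound] shows that a run that has not sunk records the correct
    coset, and [coset_run_defined] that the run on a word whose prefixes stay
    close to H never sinks. *)

Section CosetTracking.
Set Implicit Arguments.
Unset Strict Implicit.
Variables (X : finType) (G : groupType) (S : genset X G) (H : set G).
Hypothesis subH : subgroup H.

Let H1 : H 1%g.
Proof. by case: subH => /set_mem. Qed.

Let HV g : H g -> H g^-1%g.
Proof.
case: subH => _ Hdiv Hg.
by rewrite -[g^-1%g]mul1g; apply/set_mem/Hdiv; exact/mem_set.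
Qed.

Let HM g h : H g -> H h -> H (g * h)%g.
Proof.
case: subH => _ Hdiv Hg /HV Hh; rewrite -[h]invgK.
by apply/set_mem/Hdiv; exact/mem_set.
Qed.

Let HVM g h : H g -> H (g^-1 * h)%g <-> H h.
Proof.
move=> Hg; split=> [Hgh|]; last exact/HM/HV.
by rewrite -(mulVKg g h); exact: HM.
Qed.

Let eval_rcons w x : eval S (rcons w x) = (eval S w * S x)%g.
Proof. by rewrite -cats1 eval_cat {2}/eval big_cons big_nil mulg1. Qed.

(** The word u labels a geodesic from v to a point h of H. *)
Lemma short_recording_word v R :
  (exists2 h, H h & cayley_dist S v h <= R) ->
  exists u : R.-bseq X, H (v * eval S u)%g.
Proof.
case=> h Hh; rewrite /cayley_dist; case: ex_minnP => n.
move=> /asboolP/cayley_walkP[u <- vuh] _ leuR.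
by exists (Bseq leuR); rewrite vuh.
Qed.

(** [Some u] stands for the coset of all v with v * eval u in H, and [None] is
    the sink. *)
Definition coset_step R (o : option (R.-bseq X)) (x : X) : option (R.-bseq X) :=
  obind (fun u : R.-bseq X =>
    [pick u' : R.-bseq X | `[< H ((eval S u)^-1 * S x * eval S u')%g >]]) o.

Definition coset_run R (w : seq X) : option (R.-bseq X) :=
  foldl (@coset_step R) (Some [bseq]) w.

(** Once v * eval u lies in H, multiplying by its inverse turns the condition
    tested by [coset_step], which does not involve v, into the one that
    characterizes the words recording the coset of v * S x. *)
Lemma coset_stepE v u x g : H (v * eval S u)%g ->
  H ((eval S u)^-1 * S x * g)%g <-> H (v * S x * g)%g.
Proof.
by move=> Hvu; rewrite -(HVM (v * S x * g)%g Hvu) invgM !mulgA mulgVK.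
Qed.

Lemma coset_run_sound R w u :
  coset_run R w = Some u -> H (eval S w * eval S u)%g.
Proof.
rewrite /coset_run; elim/last_ind: w u => [u [<-]|w x IHw u].
  by rewrite /eval !big_nil mulg1.
rewrite foldl_rcons; case: foldl IHw => //= u0 /(_ _ erefl) Hwu0.
case: pickP => // u' /asboolP/(coset_stepE x _ Hwu0) Hu' [<-].
by rewrite eval_rcons.
Qed.

Lemma coset_run_defined R w :
  (forall i, i <= size w ->
     exists u : R.-bseq X, H (eval S (take i w) * eval S u)%g) ->
  coset_run R w.
Proof.
elim/last_ind: w => [//|w x IHw] near.
have : coset_run R w.
  apply: IHw => i lei; have := near i.
  by rewrite size_rcons -cats1 takel_cat // => /(_ (leqW lei)).
have := @coset_run_sound R w; rewrite /coset_run foldl_rcons.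
case: foldl => //= u0 /(_ _ erefl) Hwu0 _; case: pickP => // none.
have [u] := near _ (leqnn _); rewrite take_size eval_rcons.
by move=> /(coset_stepE x _ Hwu0) Hu; have /asboolP := none u.
Qed.

(** A state (q, Some u) is final only when eval u lies in H, which says that the
    recorded coset is H itself. *)
Definition coset_dfa R (A : dfa X) : dfa X :=
  @Dfa X (dfa_state A * option (R.-bseq X))%type
    (dfa_init A, Some [bseq])
    [set p : dfa_state A * option (R.-bseq X) | (p.1 \in dfa_final A) &&
             (if p.2 is Some u then `[< H (eval S u) >] else false)]%SET
    (fun p x => (dfa_trans p.1 x, coset_step p.2 x)).

Lemma coset_dfa_accepts R (A : dfa X) w :
  dfa_accepts (coset_dfa R A) w =
    dfa_accepts A w && (coset_run R w && `[< H (eval S w) >]).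
Proof.
have run p : foldl (@dfa_trans X (coset_dfa R A)) p w =
    (foldl (@dfa_trans X A) p.1 w, foldl (@coset_step R) p.2 w).
  by elim: w p => [|x w IHw] [q o] //=; rewrite IHw.
rewrite /dfa_accepts run inE /=; congr (_ && _).
rewrite -/(coset_run R w); case E: coset_run => [u|] //=.
apply: asbool_equiv_eq; have Hwu := coset_run_sound E.
by rewrite -(HVM (eval S w) Hwu) invgM mulgVK; split=> /HV //; rewrite invgK.
Qed.

End CosetTracking.

Theorem proposition4p2 (X : finType) (G : groupType) (S : genset X G)
    (L : set (seq X)) (H : set G) :
  regular L -> subgroup H -> language_convex S L H ->
  exists L_H : set (seq X),
    regular L_H /\ eval S @` L_H = H `&` (eval S @` L).
Proof.
move=> [A ->] subH [R convH].
exists [set w | dfa_accepts (coset_dfa S H R A) w].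
split; first by exists (coset_dfa S H R A).
apply/seteqP; split=> g [] /=.
  move=> w; rewrite coset_dfa_accepts // => /and3P[Lw _ /asboolP Hw] <-.
  by split=> //; exists w.
move=> Hg [w Lw wg]; subst g; exists w => //=; rewrite coset_dfa_accepts // Lw /=; apply/andP; split.
  apply: coset_run_defined => // i lei; apply: short_recording_word.
  by apply: (convH w) => //; apply/mapP; exists i; rewrite ?mem_iota.
exact/asboolP.
Qed.
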